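(* Let $\alpha$ be a peak composition of $n$. Then $\widetilde{\mathcal S}_\alpha=\widetilde{Q}_\alpha$ if and only if $\alpha=(2,2,\dots,2,k)$ or $\alpha=(2,2,\dots,2,k,1)$ for some $k\ge2$ (where the number of initial $2$'s may be zero).
   Context: Let $n$ be a nonnegative integer. A composition $\alpha=(\alpha_1,\dots,\alpha_k)$ of $n$ is a finite list of positive integers with sum $n$; $\ell(\alpha)=k$ (the empty composition is the unique composition of $0$). The diagram $D(\alpha)$ is the left-justified array with $\alpha_i$ boxes in row $i$, rows numbered from bottom to top; box $(i,j)$ lies in column $i$ and row $j$, and $T_{i,j}$ is the entry of $T$ there. A peak composition is a composition all of whose parts, except possibly the last, are greater than $1$. A filling of $D(\alpha)$ with $1,\dots,n$ satisfies the peak-tableau condition if for every $1\le k\le n$ the boxes with entries $\le k$ form the diagram of a peak composition. SPIT: for a peak composition $\alpha$, $\mathrm{SPIT}(\alpha)$ is the set of fillings of $D(\alpha)$ with $1,\dots,n$ (each once), rows increasing from left to right, first column increasing from bottom to top, satisfying the peak-tableau condition. SYCT: a standard Young composition tableau of shape $\alpha$ is a filling of $D(\alpha)$ with $1,\dots,n$ (each once), rows increasing from left to right, first column increasing from bottom to top, such that whenever $i<j$, $(k,j),(k+1,i)\in D(\alpha)$ and $T_{k,j}\le T_{k+1,i}$, then $(k+1,j)\in D(\alpha)$ and $T_{k+1,j}<T_{k+1,i}$. SPYCT: for a peak composition $\alpha$, $\mathrm{SPYCT}(\alpha)$ is the set of SYCTs of shape $\alpha$ satisfying the peak-tableau condition.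 Readings: $\mathrm{w}_{\rm c}(T)$ reads column by column starting from the leftmost column, each from bottom to top. $\mathrm{w}_{\rm Y}(T)$ reads the first column from top to bottom, then the subsequent columns from left to right, each from bottom to top. $\mathrm{Des}(\sigma)=\{i\in[n-1]\mid i$ is to the right of $i+1$ in $\sigma\}$; $\mathrm{Peak}(X)=\{i\in X\mid i>1,\ i-1\notin X\}$. For a composition $\gamma$ of $n$, $\mathrm{set}(\gamma)=\{\gamma_1,\gamma_1+\gamma_2,\dots,\gamma_1+\cdots+\gamma_{\ell(\gamma)-1}\}$; for $I=\{i_1<\cdots<i_p\}\subseteq[n-1]$, $\mathrm{comp}(I)=(i_1,i_2-i_1,\dots,n-i_p)$. $F_\gamma=\sum x_{i_1}\cdots x_{i_n}$ over $1\le i_1\le\cdots\le i_n$ with $i_j<i_{j+1}$ if $j\in\mathrm{set}(\gamma)$. For a peak composition $\gamma$ of $n$ with $I=\mathrm{set}(\gamma)$, $K_\gamma=2^{|I|+1}\sum F_\beta$ over compositions $\beta$ of $n$ with $I\subseteq\mathrm{set}(\beta)\triangle(\mathrm{set}(\beta)+1)$ ($\triangle$ symmetric difference, $\mathrm{set}(\beta)+1=\{i+1\mid i\in\mathrm{set}(\beta)\}$). Quasisymmetric Schur $Q$-function: $\widetilde{Q}_\alpha=\sum_{T\in\mathrm{SPIT}(\alpha)}K_{\mathrm{comp}(\mathrm{Peak}(\mathrm{Des}(\mathrm{w}_{\rm c}(T))))}$. Peak Young quasisymmetric Schur function: $\widetilde{\mathcal S}_\alpha=\sum_{T\in\mathrm{SPYCT}(\alpha)}K_{\mathrm{comp}(\mathrm{Peak}(\mathrm{Des}(\mathrm{w}_{\rm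 Y}(T))))}$.
   Formalization: The formal statement assumes n ≥ 2; as printed the claim fails for α=() (n=0) and α=(1) (n=1), where the two functions agree but α has neither of the listed forms with k ≥ 2. *)

(* Defs.v *)
From HB Require Import structures.
From mathcomp Require Import all_boot all_algebra finmap multiset.

Set Implicit Arguments.
Unset Strict Implicit.
Unset Printing Implicit Defensive.

Import GRing.Theory.

(** * Compositions *)

Definition is_comp (n : nat) (a : seq nat) : bool :=
  all (ltn 0) a && (sumn a == n).

Definition is_peak_comp (n : nat) (a : seq nat) : bool :=
  is_comp n a && all (ltn 1) (take (size a).-1 a).

(* A composition of n + 1 either starts with a part 1 or is obtained from a
   nonempty composition of n by incrementing its first part. *)
Fixpoint compositions (n : nat) : seq (seq nat) :=
  if n is n'.+1 then
    [seq 1 :: c | c <- compositions n'] ++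
    [seq (head 0 c).+1 :: behead c | c <- compositions n' & c != [::]]
  else [:: [::]].

Lemma mem_compositions (n : nat) (a : seq nat) :
  (a \in compositions n) = is_comp n a.
Proof.
elim: n a => [|n IHn] a; first by case: a => [|[|x] a]; rewrite /is_comp //= addSn andbF.
rewrite /= mem_cat; apply/orP/idP.
  case=> /mapP[c].
    by rewrite IHn => /andP[c0 /eqP cn] ->; rewrite /is_comp /= c0 cn add1n /=.
  rewrite mem_filter IHn => /andP[+ /andP[c0 /eqP cn]] ->.
  by case: c c0 cn => //= x c /andP[_ c0] cn _; rewrite /is_comp /= c0 addSn cn /=.
rewrite /is_comp; case: a => [|[|[|x]] a] //= /andP[a0 sa].
  by left; apply/mapP; exists a; rewrite // IHn /is_comp a0.
right; apply/mapP; exists (x.+1 :: a) => //.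
by rewrite mem_filter IHn /is_comp /= a0.
Qed.

Lemma compositions_uniq (n : nat) : uniq (compositions n).
Proof.
elim: n => //= n IHn; rewrite cat_uniq map_inj_uniq ?IHn; last by move=> ? ? [].
rewrite map_inj_in_uniq ?filter_uniq // ?andbT.
  apply/hasPn => _ /mapP[c + ->]; rewrite mem_filter mem_compositions.
  by move=> /andP[+ /andP[c0 _]]; case: c c0 => [|[|x] c] //= _ _; apply/mapP => -[].
by move=> [|x c] [|y d]; rewrite !mem_filter //= => _ _ [-> ->].
Qed.

(** [cset] is set(gamma); [comp_of n I] is comp(I) for an increasing list I of
    elements of [n-1], and is the empty composition when n = 0. *)
Definition cset (g : seq nat) : seq nat :=
  [seq sumn (take p g) | p <- iota 1 (size g).-1].

Definition comp_of (n : nat) (I : seq nat) : seq nat :=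
  if n == 0 then [::] else pairmap (fun x y => y - x) 0 (rcons I n).

(** * Diagrams and fillings
    A box is a pair (column, row); both coordinates start at 0, and row 0 is the
    bottom row.  A filling is the list of its rows, from bottom to top. *)

Definition diagram (a : seq nat) : seq (nat * nat) :=
  [seq (i, j) | j <- iota 0 (size a), i <- iota 0 (nth 0 a j)].

Definition fillings (a : seq nat) : seq (seq (seq nat)) :=
  [seq reshape a w | w <- permutations (iota 1 (sumn a))].

Definition entry (T : seq (seq nat)) (b : nat * nat) : nat :=
  nth 0 (nth [::] T b.2) b.1.

Definition column (T : seq (seq nat)) (i : nat) : seq nat :=
  [seq nth 0 r i | r <- T & i < size r].

Definition ncols (T : seq (seq nat)) : nat := foldr maxn 0 (shape T).

Definition rows_increasing (T : seq (seq nat)) : bool := all (sorted ltn) T.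

Definition first_col_increasing (T : seq (seq nat)) : bool :=
  sorted ltn (column T 0).

(* Diagrams are duplicate-free, so [perm_eq] is equality of sets of boxes; if the
   boxes with entries at most k form D(b), then b is a composition of k. *)
Definition peak_tableau (a : seq nat) (T : seq (seq nat)) : bool :=
  all (fun k =>
    has (fun b => is_peak_comp k b &&
           perm_eq [seq x <- diagram a | entry T x <= k] (diagram b))
        (compositions k))
    (iota 1 (sumn a)).

Definition SYCT_triple (a : seq nat) (T : seq (seq nat)) : bool :=
  all (fun x : nat * nat => all (fun y : nat * nat =>
    let: (k, j) := x in let: (k', i) := y in
    [&& i < j, k' == k.+1 & entry T (k, j) <= entry T (k.+1, i)] ==>
    ((k.+1, j) \in diagram a) && (entry T (k.+1, j) < entry T (k.+1, i)))
  (diagram a)) (diagram a).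

Definition SPIT (a : seq nat) : seq (seq (seq nat)) :=
  [seq T <- fillings a | [&& rows_increasing T, first_col_increasing T
                           & peak_tableau a T]].

Definition SYCT (a : seq nat) : seq (seq (seq nat)) :=
  [seq T <- fillings a | [&& rows_increasing T, first_col_increasing T
                           & SYCT_triple a T]].

Definition SPYCT (a : seq nat) : seq (seq (seq nat)) :=
  [seq T <- SYCT a | peak_tableau a T].

(** * Reading words, descents and peaks *)

Definition wc (T : seq (seq nat)) : seq nat :=
  flatten [seq column T i | i <- iota 0 (ncols T)].

Definition wY (T : seq (seq nat)) : seq nat :=
  rev (column T 0) ++ flatten [seq column T i | i <- iota 1 (ncols T).-1].

Definition Des (w : seq nat) : seq nat :=
  [seq i <- iota 1 (size w).-1 | index i.+1 w < index i w].

Definition Peak (X : seq nat) : seq nat :=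
  [seq i <- X | (1 < i) && (i.-1 \notin X)].

(** * Quasisymmetric functions
    Formal power series over the integers in x_1, x_2, ..., given by their
    coefficients; the monomial x_1^(m 1) x_2^(m 2) ... is the multiset m. *)

Definition powser : Type := multiset nat -> int.

(* The sequences i_1 <= ... <= i_n in the sum defining F_g. *)
Definition F_index (g i : seq nat) : bool :=
  [&& size i == sumn g, all (ltn 0) i, sorted leq i
    & all (fun j => nth 0 i j.-1 < nth 0 i j) (cset g)].

(* [permutations (enum_mset m)] lists without repetition all sequences i with
   x_(i_1) ... x_(i_n) = m. *)
Definition F (g : seq nat) : powser :=
  fun m => Posz (count (F_index g) (permutations (enum_mset m))).

Definition K_index (I b : seq nat) : bool :=
  all (fun i => (i \in cset b) (+) (i \in [seq x.+1 | x <- cset b])) I.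

Definition K (g : seq nat) : powser := fun m =>
  (2 ^+ (size (cset g)).+1 *
     \sum_(b <- compositions (sumn g) | K_index (cset g) b) F b m)%R.

Definition Qtilde (a : seq nat) : powser := fun m =>
  (\sum_(T <- SPIT a) K (comp_of (sumn a) (Peak (Des (wc T)))) m)%R.

Definition Stilde (a : seq nat) : powser := fun m =>
  (\sum_(T <- SPYCT a) K (comp_of (sumn a) (Peak (Des (wY T)))) m)%R.

(* Main.v *)
Require Import Defs.
From mathcomp Require Import all_boot.
From mathcomp Require Import all_algebra finmap multiset zify.

(** In a peak tableau T_(1,j) < T_(2,j) < T_(1,j+1), so i and i+1 never both lie
    in the first column; reversing that column therefore does not change the
    descents, and w_c and w_Y have the same descent set.  Since SPYCT(a) is
    contained in SPIT(a), the difference of the two functions is a sum of K's over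
    SPIT(a) \ SPYCT(a); each K has nonnegative coefficients and a positive
    coefficient at x_1 x_2 ... x_n, so equality holds iff every SPIT satisfies the
    triple condition.  The first two columns never violate it, so this is the case
    iff no row of length at least 3 lies below a row of length at least 2. *)

Set Implicit Arguments.
Unset Strict Implicit.
Unset Printing Implicit Defensive.

(** * Subsets of [n-1] and compositions of n *)

Lemma sumn_pairmap_subn x s :
  path leq x s -> x + sumn (pairmap (fun x y => y - x) x s) = last x s.
Proof.
elim: s x => [|y s IHs] x /=; first by rewrite addn0.
by case/andP=> xy /IHs <-; rewrite addnA subnKC.
Qed.

Lemma all_pairmap_subn x s :
  path ltn x s -> all (ltn 0) (pairmap (fun x y => y - x) x s).
Proof. by elim: s x => //= y s IHs x /andP[xy /IHs ->]; rewrite subn_gt0 xy. Qed.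

(** The differences telescope. The start [x] is arbitrary so that the induction can move it along
    [s]; the appended [z] affects only the last difference, which none of these partial sums
    reaches. *)
Lemma partial_sums_pairmap_subn x s z : path leq x s ->
  [seq x + sumn (take p (pairmap (fun x y => y - x) x (rcons s z)))
     | p <- iota 1 (size s)] = s.
Proof.
elim: s x => [|y s IHs] x //= /andP[xy /IHs IH].
rewrite take0 /= addn0 subnKC //; congr (_ :: _).
rewrite -[2]/(1 + 1) iotaDl -map_comp -[RHS]IH; apply: eq_map => p /=.
by rewrite addnA subnKC.
Qed.

(** Packs the condition that [I] is an increasing list in [n-1] into one path, the form suited to
    the differences taken in [comp_of]. *)
Lemma path_ltn_rcons n I : 0 < n ->
  path ltn 0 (rcons I n) = sorted ltn I && all (fun i => 0 < i < n) I.
Proof.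
move=> n0; rewrite (path_sortedE ltn_trans) (sorted_pairwise ltn_trans).
rewrite pairwise_rcons all_rcons -(sorted_pairwise ltn_trans) /= n0 /=.
by rewrite andbA -all_predI andbC.
Qed.

Lemma is_comp_comp_of n I : 0 < n -> path ltn 0 (rcons I n) ->
  is_comp n (comp_of n I).
Proof.
move=> n0 I_inc; rewrite /is_comp /comp_of -[n == 0]negbK -lt0n n0 /=.
rewrite all_pairmap_subn //= -[sumn _]add0n sumn_pairmap_subn ?last_rcons //.
by apply: sub_path I_inc => x y /ltnW.
Qed.

Lemma cset_comp_of n I : 0 < n -> path ltn 0 (rcons I n) ->
  cset (comp_of n I) = I.
Proof.
move=> n0 I_inc; rewrite /cset /comp_of -[n == 0]negbK -lt0n n0 /=.
rewrite size_pairmap size_rcons /=; apply: (@partial_sums_pairmap_subn 0).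
by move: I_inc; rewrite rcons_path => /andP[+ _]; apply: sub_path => x y /ltnW.
Qed.

(** * Positivity of the coefficients of K *)

Lemma K_ge0 g m : (0 <= K g m)%R.
Proof.
rewrite /K Num.Theory.mulr_ge0 ?Num.Theory.exprn_ge0 //.
by rewrite Num.Theory.sumr_ge0.
Qed.

(** The index sequence 1, 2, ..., n is strictly increasing everywhere, so it meets the strictness
    conditions of every [comp_of n I]. *)
Lemma F_comp_of_gt0 n I : 0 < n -> path ltn 0 (rcons I n) ->
  (0 < F (comp_of n I) (seq_mset (iota 1 n)))%R.
Proof.
move=> n0 I_inc; have /andP[_ /eqP sum_n] := is_comp_comp_of n0 I_inc.
rewrite /F ltz_nat -has_count; apply/hasP; exists (iota 1 n).
  by rewrite mem_permutations perm_sym perm_eq_seq_mset.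
rewrite /F_index sum_n size_iota eqxx cset_comp_of //=.
rewrite (sub_sorted _ (iota_ltn_sorted 1 n)) => [|x y /ltnW //].
apply/and3P; split=> //.
  by apply/allP=> x; rewrite mem_iota => /andP[].
have := I_inc; rewrite path_ltn_rcons // => /andP[_]; apply: sub_all => i /andP[i0 i_n].
by rewrite !nth_iota //; lia.
Qed.

(* [comp_of n I] is itself one of the compositions in the sum defining its K,
   because its set has no two consecutive elements. *)
Lemma K_comp_of_gt0 n I : 0 < n -> path ltn 0 (rcons I n) ->
    {in I, forall i, i.-1 \notin I} ->
  (0 < K (comp_of n I) (seq_mset (iota 1 n)))%R.
Proof.
move=> n0 I_inc sepI; rewrite /K Num.Theory.mulr_gt0 ?Num.Theory.exprn_gt0 //.
have comp_n := is_comp_comp_of n0 I_inc; have /andP[_ /eqP ->] := comp_n.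
rewrite (big_rem (comp_of n I)) ?mem_compositions //= ifT.
  by rewrite Num.Theory.ltr_wpDr ?Num.Theory.sumr_ge0 ?F_comp_of_gt0.
rewrite /K_index cset_comp_of //; apply/allP=> i iI; rewrite iI.
apply/negP=> /mapP[j jI ij].
by have := sepI i iI; rewrite ij /= jI.
Qed.

Lemma Peak_no_consecutive X : {in Peak X, forall i, i.-1 \notin Peak X}.
Proof.
by move=> i; rewrite !mem_filter => /andP[/andP[_ /negPf->]]; rewrite andbF.
Qed.

Lemma path_Peak_Des n w : 0 < n -> {subset w <= iota 1 n} ->
  path ltn 0 (rcons (Peak (Des w)) n).
Proof.
move=> n0 w_sub; rewrite path_ltn_rcons //; apply/andP; split.
  by rewrite !(sorted_filter ltn_trans) ?iota_ltn_sorted.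
apply/allP=> i; rewrite !mem_filter => /and3P[_ i_des]; rewrite mem_iota => /andP[-> _].
(* [index] returns the length of [w] for an absent value, so the strict inequality in a descent
   forces [i.+1] to occur; this bounds [i] by n-1. *)
have /w_sub : i.+1 \in w by rewrite -index_mem (leq_trans i_des) ?index_size.
by rewrite mem_iota; lia.
Qed.

(** * Boxes and entries of fillings *)

(** The default value 0 of [nth] makes the rows above the top one empty, so no separate bound on [j]
    is required. *)
Lemma mem_diagram a c j : ((c, j) \in diagram a) = (c < nth 0 a j).
Proof.
apply/allpairsPdep/idP=> [[j' [c' [+ + [-> ->]]]]|lt_c].
  by rewrite !mem_iota => _ /andP[].
exists j, c; rewrite !mem_iota; split=> //=; rewrite add0n.
by rewrite ltnNge; apply/negP=> /(nth_default 0) aj; rewrite aj in lt_c.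
Qed.

Lemma diagram_uniq a : uniq (diagram a).
Proof.
rewrite allpairs_uniq_dep ?iota_uniq // => [j _|]; first by rewrite iota_uniq.
by move=> [j c] [j' c'] _ _ [-> ->].
Qed.

Lemma size_diagram a : size (diagram a) = sumn a.
Proof.
rewrite size_allpairs_dep; congr sumn; rewrite -[RHS](mkseq_nth 0).
by apply: eq_map => j; rewrite size_iota.
Qed.

Lemma mem_fillings a T : (T \in fillings a) =
  (shape T == a) && perm_eq (flatten T) (iota 1 (sumn a)).
Proof.
apply/mapP/andP=> [[w + ->]|[/eqP <- T_perm]].
  rewrite mem_permutations => w_perm.
  have w_size : size w = sumn a by rewrite (perm_size w_perm) size_iota.
  by rewrite reshapeKl ?reshapeKr ?w_size.
by exists (flatten T); rewrite ?mem_permutations // flattenK.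
Qed.

Lemma map_entry_diagram T :
  [seq entry T b | b <- diagram (shape T)] = flatten T.
Proof.
rewrite /diagram map_allpairs; congr flatten.
rewrite -[RHS](mkseq_nth [::]) size_map; apply/eq_in_map => j.
rewrite mem_iota => lt_j; rewrite (nth_map [::]) //.
exact: mkseq_nth.
Qed.

Lemma shape_filling a T : T \in fillings a -> shape T = a.
Proof. by rewrite mem_fillings => /andP[/eqP]. Qed.

Lemma perm_entry_diagram a T : T \in fillings a ->
  perm_eq [seq entry T b | b <- diagram a] (iota 1 (sumn a)).
Proof.
rewrite mem_fillings => /andP[/eqP <- T_perm].
by rewrite map_entry_diagram.
Qed.

Lemma mem_entry a T b : T \in fillings a -> b \in diagram a ->
  entry T b \in iota 1 (sumn a).
Proof. by move=> /perm_entry_diagram /perm_mem <-; apply: map_f. Qed.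

Lemma entry_inj a T : T \in fillings a ->
  {in diagram a &, injective (entry T)}.
Proof.
move=> /perm_entry_diagram /perm_uniq; rewrite iota_uniq => T_uniq x y xD yD Txy.
rewrite -[x](nth_index x xD) -[in RHS](nth_index x yD); congr nth; apply/eqP.
rewrite -(nth_uniq 0 _ _ T_uniq) ?size_map ?index_mem //.
by rewrite !(nth_map x) ?index_mem // !nth_index // Txy.
Qed.

Lemma column_entry a T c : T \in fillings a -> column T c =
  [seq entry T (c, j) | j <- iota 0 (size a) & c < nth 0 a j].
Proof.
move=> /shape_filling <-; rewrite /column size_map.
rewrite -{1}[T](mkseq_nth [::]) filter_map -map_comp.
congr map; apply: eq_in_filter => j; rewrite mem_iota => lt_j /=.
by rewrite (nth_map [::]).
Qed.

Lemma mem_column a T c x : T \in fillings a -> x \in column T c ->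
  exists2 j, c < nth 0 a j & x = entry T (c, j).
Proof.
move=> /column_entry -> /mapP[j]; rewrite mem_filter => /andP[lt_c _] ->.
by exists j.
Qed.

Lemma lt_nth_size a c j : c < nth 0 a j -> j < size a.
Proof. by rewrite [j < _]ltnNge; apply: contraTN => /(nth_default 0) ->. Qed.

(** * Local forms of the tableau conditions *)

Lemma rows_increasingP a T : T \in fillings a ->
  reflect (forall c j, c.+1 < nth 0 a j -> entry T (c, j) < entry T (c.+1, j))
          (rows_increasing T).
Proof.
move=> /shape_filling <-; apply: (iffP (all_nthP [::])) => T_inc.
  move=> c j lt_c; have := lt_nth_size lt_c; rewrite size_map => lt_j.
  by have /(sortedP 0) := T_inc j lt_j; apply; rewrite (nth_map [::]) in lt_c.
move=> j lt_j; apply/(sortedP 0) => c lt_c; apply: T_inc.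
by rewrite (nth_map [::]).
Qed.

Lemma rows_increasing_ltn a T c d j : T \in fillings a -> rows_increasing T ->
  c < d < nth 0 a j -> entry T (c, j) < entry T (d, j).
Proof.
move=> T_fill /(rows_increasingP T_fill) T_inc.
elim: d => // d IHd; rewrite ltnS leq_eqVlt => /andP[/orP[/eqP <-|lt_c] lt_d].
  exact: T_inc.
by rewrite (ltn_trans (IHd _) (T_inc _ _ lt_d)) // lt_c ltnW.
Qed.

Lemma peak_comp_gt1 n a j : is_peak_comp n a -> j.+1 < size a -> 1 < nth 0 a j.
Proof.
move=> /andP[_ /(all_nthP 0) gt1] lt_j.
have := gt1 j; rewrite size_take nth_take; last lia.
by apply; case: ifP; lia.
Qed.

Lemma peak_comp_gt0 n a j : is_peak_comp n a -> j < size a -> 0 < nth 0 a j.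
Proof. by move=> /andP[/andP[/(all_nthP 0) gt0 _] _]; apply: gt0. Qed.

Lemma first_col_increasingP n a T : is_peak_comp n a -> T \in fillings a ->
  reflect (forall j, j.+1 < size a -> entry T (0, j) < entry T (0, j.+1))
          (first_col_increasing T).
Proof.
move=> a_peak T_fill; rewrite /first_col_increasing (column_entry _ T_fill).
rewrite (_ : [seq j <- _ | _] = iota 0 (size a)); last first.
  by apply/all_filterP/allP=> j; rewrite mem_iota; apply: (peak_comp_gt0 a_peak).
apply: (iffP (sortedP 0)); rewrite size_map size_iota => T_inc j lt_j.
  by have := T_inc j lt_j; rewrite !(nth_map 0) ?size_iota ?nth_iota ?(ltnW lt_j).
by rewrite !(nth_map 0) ?size_iota ?nth_iota ?(ltnW lt_j) //; apply: T_inc.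
Qed.

Lemma first_col_increasing_ltn n a T i j : is_peak_comp n a -> T \in fillings a ->
  first_col_increasing T -> i < j < size a -> entry T (0, i) < entry T (0, j).
Proof.
move=> a_peak T_fill /(first_col_increasingP a_peak T_fill) T_inc.
elim: j => // j IHj; rewrite ltnS leq_eqVlt => /andP[/orP[/eqP <-|lt_i] lt_j].
  exact: T_inc.
by rewrite (ltn_trans (IHj _) (T_inc _ lt_j)) // lt_i ltnW.
Qed.

(** Take k to be the entry of box (0, j+1). The boxes with entries at most k then include row j+1,
    so row j is not their last row and has at least two of them. *)
Lemma peak_tableau_entry n a T j : is_peak_comp n a -> T \in fillings a ->
  peak_tableau a T -> j.+1 < size a -> entry T (1, j) < entry T (0, j.+1).
Proof.
move=> a_peak T_fill /allP T_peak lt_j.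
have jD : (0, j.+1) \in diagram a by rewrite mem_diagram (peak_comp_gt0 a_peak).
have j'D : (1, j) \in diagram a by rewrite mem_diagram (peak_comp_gt1 a_peak).
have /hasP[b _ /andP[b_peak /perm_mem Db]] := T_peak _ (mem_entry T_fill jD).
have := Db (0, j.+1); rewrite mem_filter leqnn jD /= mem_diagram => /esym/lt_nth_size.
move=> /(peak_comp_gt1 b_peak); rewrite -mem_diagram -Db mem_filter => /andP[le1 _].
rewrite ltn_neqAle le1 andbT; apply/eqP=> /(entry_inj T_fill j'D jD).
by case.
Qed.

(** A downward closed predicate holds exactly on an initial segment, whose length is its count. *)
Lemma ltn_count_iota (P : pred nat) N :
    (forall i, i.+1 < N -> P i.+1 -> P i) ->
  forall j, j < N -> (j < count P (iota 0 N)) = P j.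
Proof.
elim: N => // N IHN P_down j; have P_down' i : i.+1 < N -> P i.+1 -> P i.
  by move=> lt_i; apply: P_down; rewrite ltnW.
have -> : iota 0 N.+1 = iota 0 N ++ [:: N] by rewrite -addn1 iotaD.
rewrite count_cat /= addn0 ltnS.
have [PN|nPN] := boolP (P N).
  have PT i : i <= N -> P i.
    move=> /subnKC; move: (N - i) => d; elim: d i => [|d IHd] i.
      by rewrite addn0 => ->.
    by rewrite addnS -addSn => iN; apply: P_down (IHd _ iN); lia.
  have -> : count P (iota 0 N) = N.
    rewrite -[RHS](size_iota 0); apply/eqP; rewrite -all_count; apply/allP=> i.
    by rewrite mem_iota => /ltnW/PT.
  by move=> le_j; rewrite addn1 ltnS le_j PT.
rewrite addn0 leq_eqVlt; case: (ltngtP j N) => //= [lt_j _|-> _]; first exact: IHN.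
by rewrite (negPf nPN) ltnNge -{2}(size_iota 0 N) count_size.
Qed.

Lemma entry_peak_tableau n a T : is_peak_comp n a -> T \in fillings a ->
    rows_increasing T ->
    (forall j, j.+1 < size a -> entry T (1, j) < entry T (0, j.+1)) ->
  peak_tableau a T.
Proof.
move=> a_peak T_fill T_row T_peak; apply/allP=> k; rewrite mem_iota => k_n.
have T_row' := elimT (rows_increasingP T_fill) T_row.
(* The boxes with entries at most [k] fill an initial segment of each row, of length [row j], and
   meet exactly the lowest [m] rows; the required composition is therefore [mkseq row m]. *)
pose row j := count (fun c => entry T (c, j) <= k) (iota 0 (nth 0 a j)).
pose m := count (fun j => entry T (0, j) <= k) (iota 0 (size a)).
have rowP c j : c < nth 0 a j -> (c < row j) = (entry T (c, j) <= k).
  move=> lt_c; rewrite /row (@ltn_count_iota (fun c => entry T (c, j) <= k)) //.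
  by move=> d lt_d; apply: leq_trans; rewrite ltnW ?T_row'.
have mP j : j < size a -> (j < m) = (entry T (0, j) <= k).
  move=> lt_j; rewrite /m (@ltn_count_iota (fun j => entry T (0, j) <= k)) //.
  move=> i lt_i; apply: leq_trans; rewrite ltnW // (ltn_trans _ (T_peak i lt_i)) //.
  by rewrite T_row' ?(peak_comp_gt1 a_peak).
have row_le j : row j <= nth 0 a j by rewrite -[leqRHS](size_iota 0) count_size.
have m_le : m <= size a by rewrite -[leqRHS](size_iota 0) count_size.
have D_eq : perm_eq [seq x <- diagram a | entry T x <= k] (diagram (mkseq row m)).
  apply: uniq_perm; rewrite ?filter_uniq ?diagram_uniq // => -[c j].
  rewrite mem_filter !mem_diagram; have [lt_j|le_j] := ltnP j m.
    rewrite nth_mkseq //; have [lt_c|le_c] := ltnP c (nth 0 a j).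
      by rewrite rowP ?andbT.
    by rewrite andbF ltnNge (leq_trans (row_le j)).
  rewrite [RHS](_ : _ = false); last by rewrite nth_default ?size_mkseq.
  apply/andP=> -[le_k lt_c]; have lt_j := lt_nth_size lt_c.
  have : j < m; last by rewrite ltnNge le_j.
  rewrite mP // (leq_trans _ le_k) //; case: c {le_k} lt_c => // c lt_c.
  by rewrite ltnW // (rows_increasing_ltn T_fill).
have comp_k : is_comp k (mkseq row m).
  apply/andP; split; last first.
    (* The parts sum to the number of entries at most [k], and these are exactly 1, ..., k. *)
    rewrite -size_diagram -(perm_size D_eq) size_filter.
    rewrite -(count_map (entry T) (leq^~ k)).
    rewrite (permP (perm_entry_diagram T_fill)).
    rewrite (_ : sumn a = k + (sumn a - k)); last lia.
    rewrite iotaD count_cat (_ : count _ (iota 1 k) = k); last first.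
      rewrite -[RHS](size_iota 1); apply/eqP; rewrite -all_count; apply/allP=> i.
      by rewrite mem_iota; lia.
    rewrite (_ : count _ _ = 0) ?addn0 //; apply/eqP; rewrite -leqn0 leqNgt -has_count.
    by apply/hasPn => i; rewrite mem_iota /=; lia.
  apply/(all_nthP 0) => j; rewrite size_mkseq => lt_j; rewrite nth_mkseq //=.
  have lt_j' := leq_trans lt_j m_le.
  by rewrite rowP ?(peak_comp_gt0 a_peak) // -mP.
apply/hasP; exists (mkseq row m); rewrite ?mem_compositions // D_eq andbT.
(* If row j+1 has an entry at most [k], so does box (0, j+1), and the smaller entry of box (1, j)
   gives row j a second box. *)
apply/andP; split=> //; apply/(all_nthP 0) => j.
rewrite size_take_min size_mkseq => lt_j; rewrite nth_take; last lia.
have lt_jm : j.+1 < m by lia.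
have lt_j' := leq_trans lt_jm m_le.
rewrite nth_mkseq; last lia.
by rewrite /= rowP ?(peak_comp_gt1 a_peak) // ltnW // (leq_trans (T_peak j lt_j')) // -mP.
Qed.

(** The two inequalities chain to T(0,j) < T(1,j) < T(0,j+1), which yields the increase of the first
    column. *)
Lemma SPITP n a T : is_peak_comp n a -> T \in fillings a ->
  reflect ((forall c j, c.+1 < nth 0 a j -> entry T (c, j) < entry T (c.+1, j)) /\
           (forall j, j.+1 < size a -> entry T (1, j) < entry T (0, j.+1)))
          (T \in SPIT a).
Proof.
move=> a_peak T_fill; rewrite mem_filter T_fill andbT.
apply: (iffP and3P) => [[T_row _ T_peak]|[T_row T_peak]].
  by split; [apply/(rows_increasingP T_fill) | move=> j; apply: (peak_tableau_entry a_peak)].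
have T_row' : rows_increasing T by apply/(rows_increasingP T_fill).
split=> //; last exact: entry_peak_tableau a_peak _ _ _.
apply/(first_col_increasingP a_peak T_fill) => j lt_j.
by rewrite (ltn_trans _ (T_peak j lt_j)) // T_row // (peak_comp_gt1 a_peak).
Qed.

Lemma SPIT_filling a T : T \in SPIT a -> T \in fillings a.
Proof. by rewrite mem_filter => /andP[]. Qed.

Lemma SPIT_col01 n a T i j : is_peak_comp n a -> T \in SPIT a ->
  i < j < size a -> entry T (1, i) < entry T (0, j).
Proof.
move=> a_peak T_spit /andP[lt_i lt_j]; have T_fill := SPIT_filling T_spit.
have /(SPITP a_peak T_fill)[_ T_peak] := T_spit.
move: T_spit; rewrite mem_filter => /andP[/and3P[_ T_col _] _].
have lt_i' := leq_ltn_trans lt_i lt_j.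
apply: leq_trans (T_peak i lt_i') _; move: lt_i; rewrite leq_eqVlt => /orP[/eqP->//|lt_i].
by rewrite ltnW // (first_col_increasing_ltn a_peak) // lt_i.
Qed.

(** * Descents of the two reading words *)

(** Reversing the prefix affects only the order of two of its own members: a member still precedes
    every non-member. *)
Lemma index_rev_cat_ltn (U : eqType) (s t : seq U) x y : ~~ ((x \in s) && (y \in s)) ->
  (index x (rev s ++ t) < index y (rev s ++ t)) =
  (index x (s ++ t) < index y (s ++ t)).
Proof.
rewrite !index_cat !mem_rev size_rev.
have lt_s z u : z \in s -> index z (rev s) < size s + u.
  by move=> zs; rewrite -size_rev ltn_addr // index_mem mem_rev.
have lt_s' z u : z \in s -> index z s < size s + u.
  by move=> zs; rewrite ltn_addr // index_mem.
case: ifP => [/[dup] xs /lt_s lt_x|_]; case: ifP => [/[dup] ys /lt_s lt_y|_] //= _.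
  by rewrite lt_x lt_s'.
by rewrite [LHS]ltnNge [RHS]ltnNge (ltnW (lt_y _)) (ltnW (lt_s' _ _ ys)).
Qed.

Lemma Des_wY n a T : 0 < n -> is_peak_comp n a -> T \in SPIT a ->
  Des (wY T) = Des (wc T).
Proof.
move=> n0 a_peak T_spit; have T_fill := SPIT_filling T_spit.
have wcE : wc T = column T 0 ++ flatten [seq column T i | i <- iota 1 (ncols T).-1].
  rewrite /wc; case E: (ncols T) => [|N] //=; rewrite cats0.
  rewrite (column_entry _ T_fill).
  have := shape_filling T_fill; move: E a_peak; rewrite /ncols => + + shT; rewrite shT.
  case: a {T_spit T_fill shT} => [|[|x] a] //=.
  by move/eqP; rewrite -leqn0 geq_max.
rewrite /Des wcE /wY !size_cat size_rev; apply: eq_in_filter => i _.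
apply: index_rev_cat_ltn; apply/andP=> -[].
move=> /(mem_column T_fill)[j' lt_j' iE'] /(mem_column T_fill)[j lt_j iE].
(* Here [i] is in row [j] and [i.+1] in row [j']. If [j < j'], the entry of box (1, j) would lie
   strictly between them; if [j' < j], the first column would not increase. *)
have [lt_jj|lt_jj|jj] := ltngtP j j'; last by move: iE'; rewrite -jj -iE; lia.
  have lt_s := lt_nth_size lt_j'.
  have := @SPIT_col01 n a T j j' a_peak T_spit; rewrite lt_jj lt_s => /(_ isT).
  have /(SPITP a_peak T_fill)[/(_ 0 j) + _] := T_spit.
  by rewrite (peak_comp_gt1 a_peak) ?(leq_ltn_trans lt_jj) // => /(_ isT); lia.
have := @first_col_increasing_ltn n a T j' j a_peak T_fill.
rewrite lt_jj (lt_nth_size lt_j) -iE -iE'.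
move: T_spit; rewrite mem_filter => /andP[/and3P[_ -> _] _] /(_ isT isT); lia.
Qed.

Lemma wc_sub a T : T \in fillings a -> {subset wc T <= iota 1 (sumn a)}.
Proof.
move=> T_fill x /flattenP[_ /mapP[c _ ->]] /(mem_column T_fill)[j lt_c ->].
by apply: (mem_entry T_fill); rewrite mem_diagram.
Qed.

(** * Reduction to the triple condition *)

Lemma SPYCT_filter a : SPYCT a = [seq T <- SPIT a | SYCT_triple a T].
Proof.
rewrite /SPYCT /SYCT /SPIT -!filter_predI; apply: eq_filter => T /=.
by case: rows_increasing; case: first_col_increasing; case: SYCT_triple; case: peak_tableau.
Qed.

Lemma sumn_peak_comp n a : is_peak_comp n a -> sumn a = n.
Proof. by move=> /andP[/andP[_ /eqP]]. Qed.

Lemma Stilde_eq_Qtilde n a : 0 < n -> is_peak_comp n a ->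
  Stilde a =1 Qtilde a <-> {in SPIT a, forall T, SYCT_triple a T}.
Proof.
move=> n0 a_peak.
pose k T := K (comp_of n (Peak (Des (wc T)))).
have StE m : Stilde a m = (\sum_(T <- SPIT a | SYCT_triple a T) k T m)%R.
  rewrite /Stilde SPYCT_filter big_filter (sumn_peak_comp a_peak) big_seq_cond.
  rewrite [RHS]big_seq_cond; apply: eq_bigr => T /andP[T_spit _].
  by rewrite (Des_wY n0 a_peak).
have QtE m : (Qtilde a m = Stilde a m + \sum_(T <- SPIT a | ~~ SYCT_triple a T) k T m)%R.
  by rewrite StE /Qtilde (sumn_peak_comp a_peak) (bigID (SYCT_triple a)).
split=> [eqSQ T T_spit|T_triple m]; last first.
  rewrite QtE big_seq_cond big_pred0 ?GRing.addr0 // => T.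
  by apply/andP=> -[/T_triple ->].
(* At the monomial x_1 ... x_n the nonnegative terms sum to zero, yet the term of the offending [T]
   is positive. *)
apply/negPn/negP=> T_triple; pose m := seq_mset (iota 1 n).
have := QtE m; rewrite -eqSQ -[LHS]GRing.addr0 => /GRing.addrI/esym/eqP.
rewrite Num.Theory.psumr_eq0 => [/allP/(_ T T_spit)|T' _]; last exact: K_ge0.
rewrite T_triple /= => /eqP kT0.
suff : (0 < k T m)%R by rewrite kT0.
apply: K_comp_of_gt0 => //; last exact: Peak_no_consecutive.
apply: path_Peak_Des => //; rewrite -(sumn_peak_comp a_peak).
exact: wc_sub (SPIT_filling T_spit).
Qed.

(** * Shapes all of whose SPITs satisfy the triple condition *)

(** Number the boxes in the order obtained by sorting them by [key]. Boxes with equal keys come in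
    an unspecified order, so only strict inequalities carry over. *)
Lemma exists_filling_key a (key : nat * nat -> nat) :
  exists2 T, T \in fillings a &
    {in diagram a &, forall x y, key x < key y -> entry T x < entry T y}.
Proof.
pose L := sort (relpre key leq) (diagram a).
pose f b := (index b L).+1.
have perm_L : perm_eq L (diagram a) by rewrite perm_sort.
have w_perm : perm_eq (map f (diagram a)) (iota 1 (sumn a)).
  rewrite -(permPl (perm_map f perm_L)) -size_diagram -(perm_size perm_L).
  rewrite (_ : map f L = iota 1 (size L)) //.
  apply: (@eq_from_nth _ 0) => [|i]; rewrite size_map ?size_iota // => lt_i.
  rewrite (nth_map (0, 0)) // nth_iota // /f index_uniq //.
  by rewrite (perm_uniq perm_L) diagram_uniq.
have w_size : size (map f (diagram a)) = sumn a by rewrite size_map size_diagram.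
pose T := reshape a (map f (diagram a)).
have shT : shape T = a by rewrite reshapeKl ?w_size.
have flT : flatten T = map f (diagram a) by rewrite reshapeKr ?w_size.
have T_fill : T \in fillings a by rewrite mem_fillings shT flT eqxx.
have T_entry : {in diagram a, entry T =1 f}.
  by apply/eq_in_map; rewrite -flT -{1}shT map_entry_diagram.
exists T => // x y xD yD; apply: contraTT; rewrite -!leqNgt !T_entry // ltnS.
have key_tr : transitive (relpre key leq) by move=> u v w; apply: leq_trans.
have key_refl : reflexive (relpre key leq) by move=> u; apply: leqnn.
apply: (sorted_leq_index key_tr key_refl); rewrite ?(perm_mem perm_L) //.
by apply: sort_sorted => u v; apply: leq_total.
Qed.

Lemma SPIT_not_SYCT n a i j : is_peak_comp n a ->
    i < j -> 2 < nth 0 a i -> 1 < nth 0 a j ->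
  exists2 T, T \in SPIT a & ~~ SYCT_triple a T.
Proof.
move=> a_peak lt_ij gt2_i gt1_j.
(* The first two columns are filled row by row before the remaining ones, which
   makes [T_(2,j) < T_(3,i)], while [T_(3,i) < T_(3,j)] if the latter exists. *)
pose key (x : nat * nat) := if x.1 < 2 then x.2.*2 + x.1 else (size a).*2 + x.2 + x.1.
have [T T_fill T_key] := exists_filling_key a key.
exists T.
  apply/(SPITP a_peak T_fill); split=> [c k lt_c | k lt_k]; apply: T_key.
  - by rewrite mem_diagram ltnW.
  - by rewrite mem_diagram.
  (* Keys in the first two columns are at most [(size a).*2 - 1], below all keys further right;
     within a row the key increases in each range. *)
  - by have := lt_nth_size lt_c; rewrite /key; case: c {lt_c} => [|[|c]] /=; lia.
  - by rewrite mem_diagram (peak_comp_gt1 a_peak).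
  - by rewrite mem_diagram (peak_comp_gt0 a_peak).
  - by rewrite /key /=; lia.
have D1j : (1, j) \in diagram a by rewrite mem_diagram.
have D2i : (2, i) \in diagram a by rewrite mem_diagram.
have lt_j := lt_nth_size gt1_j.
apply/negP=> /allP/(_ _ D1j)/allP/(_ _ D2i); rewrite lt_ij eqxx /= ltnW /=.
  move=> /andP[D2j]; rewrite ltnNge ltnW // T_key // /key /=; lia.
by rewrite T_key // /key /=; lia.
Qed.

(** In the first two columns the premise of the triple condition contradicts [SPIT_col01]. Further
    right it needs row [i] of length at least 3 and row [j] of length at least 2, which [a_le]
    excludes. *)
Lemma SPIT_SYCT_triple n a T : is_peak_comp n a -> T \in SPIT a ->
    (forall i j, i < j -> 2 < nth 0 a i -> nth 0 a j <= 1) ->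
  SYCT_triple a T.
Proof.
move=> a_peak T_spit a_le.
apply/allP=> -[k j] kD; apply/allP=> -[k' i] k'D; apply/implyP=> /and3P[lt_ij /eqP k'E].
rewrite {}k'E mem_diagram in k'D; rewrite mem_diagram in kD.
case: k kD k'D => [|k] kD k'D.
  by rewrite leqNgt (SPIT_col01 a_peak) // lt_ij (lt_nth_size kD).
have := a_le i j lt_ij; lia.
Qed.

(** Induction on the parts: a first part above 2 forces the next part to be 1, hence last, while a
    first part 2 is stripped. The composition (1) satisfies the row condition without having the
    stated form, whence [1 < n]. *)
Lemma nseq2_compP n a : 1 < n -> is_peak_comp n a ->
  (forall i j, i < j -> 2 < nth 0 a i -> nth 0 a j <= 1) <->
  exists p k : nat, 2 <= k /\ (a = nseq p 2 ++ [:: k] \/ a = nseq p 2 ++ [:: k; 1]).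
Proof.
move=> n1 a_peak; split=> [|[p [k [k2 aE]]] i j lt_ij]; last first.
  have nth_i b : nth 0 (nseq p 2 ++ b) i = if i < p then 2 else nth 0 b (i - p).
    by rewrite nth_cat size_nseq nth_nseq; case: (i < p).
  case: (ltnP i p) nth_i => le_i nth_i; first by case: aE => ->; rewrite nth_i.
  have nth_j b : nth 0 (nseq p 2 ++ b) j = nth 0 b (j - p).
    by rewrite nth_cat size_nseq ltnNge (leq_trans le_i) // ltnW.
  (* Since [p <= i < j], the index [j - p] is positive and selects either the final part 1 or the
     default 0. *)
  by case: aE => -> _; rewrite nth_j; case E: (j - p) => [|[|[|?]]] //; lia.
elim: a n n1 a_peak => [|x l IHl] n n1 a_peak a_le.
  by have := sumn_peak_comp a_peak; rewrite /=; lia.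
have sum_n := sumn_peak_comp a_peak.
case: l => [|y l] in IHl a_peak a_le sum_n *.
  by exists 0, x; split; [move: sum_n => /=; lia | left].
have x2 := @peak_comp_gt1 n _ 0 a_peak isT.
have y1 := @peak_comp_gt0 n _ 1 a_peak isT.
have l_peak : is_peak_comp (n - x) (y :: l).
  move: a_peak; rewrite /is_peak_comp /is_comp /= => /andP[/andP[/andP[_ ->] _]].
  by rewrite -sum_n addKn eqxx /= => /andP[_ ->].
have l_nil : y = 1 -> l = [::].
  move=> yE; apply/size0nil/eqP; rewrite -leqn0 leqNgt; apply/negP=> l_gt0.
  by have := @peak_comp_gt1 n _ 1 a_peak l_gt0; rewrite /= yE.
have [x_gt|x_le] := ltnP 2 x.
  have yE : y = 1 by have := a_le 0 1 isT x_gt; move: y1 => /=; lia.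
  by exists 0, x; rewrite (l_nil yE) yE; split=> //; right.
have xE : x = 2 by move: x2 => /=; lia.
have [nx|nx] := ltnP 1 (n - x).
  have [|p [k [k2 aE]]] := IHl _ nx l_peak.
    by move=> i j lt_ij; apply: (a_le i.+1 j.+1).
  by exists p.+1, k; split=> //; rewrite xE /=; case: aE => <-; [left|right].
(* The tail has sum 1, too small for the induction hypothesis, so [a] is (2, 1). *)
have yE : y = 1 by move: y1 (sumn_peak_comp l_peak) => /=; lia.
by exists 0, 2; rewrite (l_nil yE) yE xE; split=> //; right.
Qed.

Theorem proposition4p13 (n : nat) (a : seq nat)
  (n_gt1 : 1 < n) (a_peak : is_peak_comp n a) :
  Stilde a =1 Qtilde a <->
  exists p k : nat, 2 <= k /\ (a = nseq p 2 ++ [:: k] \/ a = nseq p 2 ++ [:: k; 1]).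
Proof.
rewrite -(nseq2_compP n_gt1 a_peak) (Stilde_eq_Qtilde (ltnW n_gt1) a_peak).
split=> [T_triple i j lt_ij gt2_i|a_le T T_spit]; last exact: SPIT_SYCT_triple a_peak _ _.
rewrite leqNgt; apply/negP=> gt1_j.
by have [T /T_triple->] := SPIT_not_SYCT a_peak lt_ij gt2_i gt1_j.
Qed.
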